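(* Consider online label shift adaptation with the re-weighting hypothesis class and the Follow The History (FTH) algorithm as described in the context, run for $T\ge1$ steps. Suppose that $C_{f_0,Q_0}$ is invertible and that: (1) (Symmetric optimality with $\delta=0$) for every $\mathbf{q}\in\Delta^{M-1}$, $\left\lVert\mathbf{q}-\arg\min_{\mathbf{p}\in\Delta^{M-1}}\ell(\mathbf{p};\mathbf{q})\right\rVert_2\le 0$, i.e. $\mathbf{q}=\arg\min_{\mathbf{p}\in\Delta^{M-1}}\ell(\mathbf{p};\mathbf{q})$; (2) (Lipschitzness) $L:=\sup_{\mathbf{p},\mathbf{q}\in\Delta^{M-1}}\left\lVert\nabla_{\mathbf{p}}\ell(\mathbf{p};\mathbf{q})\right\rVert_2$ is finite. Then, with probability at least $1-2MT^{-7}$ over the samples $(\mathbf{x}_t,y_t)\sim Q_t$, $t=1,\dots,T$, the FTH iterates $\mathbf{p}_1,\dots,\mathbf{p}_T$ satisfy $$\frac1T\sum_{t=1}^T\ell(\mathbf{p}_t;\mathbf{q}_t)-\inf_{\mathbf{p}\in\Delta^{M-1}}\frac1T\sum_{t=1}^T\ell(\mathbf{p};\mathbf{q}_t)\le 2L\frac{\ln T}{T}+4Lc\sqrt{\frac{M\ln T}{T}},$$ where $c=2\max_{i=1,\dots,M}\left\lVert\left(C_{f_0,Q_0}^\top\right)^{-1}\mathbf{e}_i\right\rVert_\infty$.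
   Context: Basic setting. $\mathcal{X}$ is a feature space, $\mathcal{Y}=\{1,\dots,M\}$, $\Delta^{M-1}$ is the probability simplex in $\mathbb{R}^M$, and $\mathbf{e}_i$ is the $i$-th standard basis vector. $Q_0$ is a fixed training distribution on $\mathcal{X}\times\mathcal{Y}$ with class-conditionals $Q_0(\mathbf{x}\mid y)$ and label marginal vector $\mathbf{q}_0\in\Delta^{M-1}$, whose entries are positive. For $t=1,\dots,T$, $Q_t$ is a fixed distribution with the same class-conditionals, $Q_t(\mathbf{x}\mid y)=Q_0(\mathbf{x}\mid y)$, and label marginal vector $\mathbf{q}_t\in\Delta^{M-1}$, $\mathbf{q}_t[i]=\mathbb{P}_{Q_t}(y_t=i)$. The samples $(\mathbf{x}_t,y_t)\sim Q_t$, $t=1,\dots,T$, are independent; the learner sees only $\mathbf{x}_t$. Classifiers. For a classifier $f:\mathcal{X}\to\mathcal{Y}$ the confusion matrix is $C_{f,Q_0}[i,j]=\mathbb{P}_{\mathbf{x}\sim Q_0(\cdot\mid y=i)}(f(\mathbf{x})=j)$, and $\mathsf{diag}(\cdot)$ denotes the vector of diagonal entries. The base classifier $f_0$ outputs a probability vector $P_{f_0}(\mathbf{x})\in\Delta^{M-1}$ and predicts $f_0(\mathbf{x})=\arg\max_y P_{f_0}(\mathbf{x})[y]$. For a re-weighting vector $\mathbf{p}\in\mathbb{R}^M$, the re-weighted classifier is $$g(\mathbf{x};f_0,\mathbf{q}_0,\mathbf{p})=\arg\max_{y\in\mathcal{Y}}\frac{\mathbf{p}[y]}{\mathbf{q}_0[y]}P_{f_0}(\mathbf{x})[y]$$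 (ties broken by a fixed rule; the paper's positive normalization factor, which does not affect the argmax, is omitted). Loss. For $\mathbf{q}\in\mathbb{R}^M$, $\ell(\mathbf{p};\mathbf{q})=\left\langle\mathbf{1}-\mathsf{diag}\left(C_{g(\cdot;f_0,\mathbf{q}_0,\mathbf{p}),Q_0}\right),\mathbf{q}\right\rangle$. For $\mathbf{q}=\mathbf{q}_t$ it equals the expected 0-1 loss $\mathbb{P}_{(\mathbf{x},y)\sim Q_t}(g(\mathbf{x};f_0,\mathbf{q}_0,\mathbf{p})\ne y)$. Gradients in $\mathbf{p}$ are taken in $\mathbb{R}^M$ at points of $\Delta^{M-1}$, and their existence is part of hypothesis (2). Estimator. $\hat{\mathbf{q}}_t=\left(C_{f_0,Q_0}^\top\right)^{-1}\mathbf{e}_{f_0(\mathbf{x}_t)}$. FTH. $\mathbf{p}_1=\mathbf{q}_0$ (so that the first classifier is $f_0$), and $\mathbf{p}_{t+1}=\frac1t\sum_{\tau=1}^t\hat{\mathbf{q}}_\tau$ for $t\ge1$. Exact values of $C_{\cdot,Q_0}$ are assumed available. *)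

(* Defs.v *)
From HB Require Import structures.
From mathcomp Require Import all_boot all_order all_algebra.
From mathcomp Require Import all_classical all_reals all_analysis.

Set Implicit Arguments.
Unset Strict Implicit.
Unset Printing Implicit Defensive.

Import Order.TTheory GRing.Theory Num.Theory.
Import numFieldNormedType.Exports.

Local Open Scope classical_set_scope.
Local Open Scope ring_scope.

(* A measurable type has to be inhabited, hence M = n.+1 labels rather than
   a bare M (which is nonzero anyway, a label distribution being given); every
   set of labels is measurable. *)
HB.instance Definition _ (n : nat) := isPointed.Build 'I_n.+1 ord0.
HB.instance Definition _ (n : nat) :=
  @isMeasurable.Build default_measure_display 'I_n.+1
    (@discrete_measurable 'I_n.+1) (@discrete_measurable0 'I_n.+1)
    (@discrete_measurableC 'I_n.+1) (@discrete_measurableU 'I_n.+1).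

Definition simplex (R : realType) (M : nat) : set 'cV[R]_M :=
  [set p | (forall i, 0 <= p i 0) /\ \sum_i p i 0 = 1].
Arguments simplex : clear implicits.

(* The library norm on matrices is the max norm; this is the Euclidean one. *)
Definition l2norm (R : realType) (M : nat) (v : 'cV[R]_M) : R :=
  Num.sqrt (\sum_i v i 0 ^+ 2).

(* Only meaningful where f is differentiable. *)
Definition grad (R : realType) (M : nat) (f : 'cV[R]_M -> R^o)
    (p : 'cV[R]_M) : 'cV[R]_M :=
  \col_i 'D_(delta_mx i 0) f p.

Definition argmin_on (R : realType) (T : Type) (A : set T) (f : T -> R)
    : set T :=
  [set a | A a /\ forall b, A b -> f a <= f b].

Definition label_marginal (R : realType) (d : measure_display)
    (X : measurableType d) (n : nat)
    (Q : probability (X * 'I_n.+1)%type R) : 'cV[R]_n.+1 :=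
  \col_i fine (Q (setT `*` [set i])).

(* Q(x \in A | y = i), meaningful when label i has positive probability. *)
Definition class_cond (R : realType) (d : measure_display)
    (X : measurableType d) (n : nat)
    (Q : probability (X * 'I_n.+1)%type R) (i : 'I_n.+1) (A : set X) : R :=
  fine (Q (A `*` [set i])) / label_marginal Q i 0.

(* Nothing is required at labels of Q-probability zero, where conditioning
   on the label is undefined. *)
Definition same_class_cond (R : realType) (d : measure_display)
    (X : measurableType d) (n : nat)
    (Q0 Q : probability (X * 'I_n.+1)%type R) : Prop :=
  forall i, 0 < label_marginal Q i 0 ->
  forall A, measurable A -> class_cond Q i A = class_cond Q0 i A.

Definition mutually_independent (R : realType) (d d' : measure_display)
    (Omega : measurableType d) (S : measurableType d')
    (P : probability Omega R) (I : finType) (Z : I -> Omega -> S) : Prop :=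
  forall (J : {set I}) (B : I -> set S), (forall j, measurable (B j)) ->
  P (\bigcap_(j in [set` J]) (Z j @^-1` B j))
    = (\prod_(j in J) P (Z j @^-1` B j))%E.

(* tie is a fixed tie-breaking rule: it picks a label from the set of
   maximizers. *)
Definition argmax_label (R : realType) (M : nat) (tie : {set 'I_M} -> 'I_M)
    (w : 'I_M -> R) : 'I_M :=
  tie [set y | [forall y', w y' <= w y]]%SET.

Definition base_classifier (R : realType) (X : Type) (M : nat)
    (tie : {set 'I_M} -> 'I_M) (Pf0 : X -> 'cV[R]_M) (x : X) : 'I_M :=
  argmax_label tie (fun y => Pf0 x y 0).

Definition reweighted (R : realType) (X : Type) (M : nat)
    (tie : {set 'I_M} -> 'I_M) (Pf0 : X -> 'cV[R]_M) (q0 p : 'cV[R]_M)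
    (x : X) : 'I_M :=
  argmax_label tie (fun y => p y 0 / q0 y 0 * Pf0 x y 0).

Definition confusion (R : realType) (d : measure_display)
    (X : measurableType d) (n : nat)
    (Q0 : probability (X * 'I_n.+1)%type R) (f : X -> 'I_n.+1) : 'M[R]_n.+1 :=
  \matrix_(i, j) class_cond Q0 i (f @^-1` [set j]).

Definition loss (R : realType) (d : measure_display)
    (X : measurableType d) (n : nat)
    (Q0 : probability (X * 'I_n.+1)%type R) (tie : {set 'I_n.+1} -> 'I_n.+1)
    (Pf0 : X -> 'cV[R]_n.+1) (p q : 'cV[R]_n.+1) : R :=
  let C := confusion Q0 (reweighted tie Pf0 (label_marginal Q0) p) in
  \sum_i (1 - C i i) * q i 0.

(* The argmin over p is required to be a single point, as the distance from q
   to it presupposes. *)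
Definition symmetric_optimality (R : realType) (M : nat)
    (l : 'cV[R]_M -> 'cV[R]_M -> R) (delta : R) : Prop :=
  forall q, simplex R M q ->
  exists2 p, argmin_on (simplex R M) (fun p' => l p' q) = [set p]
           & l2norm (q - p) <= delta.

Definition grad_norms (R : realType) (M : nat)
    (l : 'cV[R]_M -> 'cV[R]_M -> R) : set R :=
  [set l2norm (grad (fun p' => l p' q) p) | p in simplex R M & q in simplex R M].

Definition lipschitz_constant (R : realType) (M : nat)
    (l : 'cV[R]_M -> 'cV[R]_M -> R) : R := sup (grad_norms l).

Definition lipschitzness (R : realType) (M : nat)
    (l : 'cV[R]_M -> 'cV[R]_M -> R) : Prop :=
  (forall p q, simplex R M p -> simplex R M q ->
     differentiable ((fun p' => l p' q) : 'cV[R]_M -> R^o) p)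
  /\ has_ubound (grad_norms l).

(* The estimate of the label marginal from a sample predicted as label j. *)
Definition label_estimate (R : realType) (M : nat) (C : 'M[R]_M) (j : 'I_M)
    : 'cV[R]_M :=
  invmx C^T *m delta_mx j 0.

(* Here `| _ | is the max norm. *)
Definition estimate_bound (R : realType) (M : nat) (C : 'M[R]_M) : R :=
  2 * \big[Num.max/0]_(i < M) `|label_estimate C i|.

(* Rounds are numbered from 0: for k < T, fth q0 qhat k is the iterate
   p_(k+1), computed from the k earlier estimates. *)
Definition fth (R : realType) (M T : nat) (q0 : 'cV[R]_M)
    (qhat : 'I_T -> 'cV[R]_M) (k : nat) : 'cV[R]_M :=
  if k is 0%N then q0 else k%:R^-1 *: \sum_(s < T | (s < k)%N) qhat s.

Definition fth_regret (R : realType) (M T : nat)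
    (l : 'cV[R]_M -> 'cV[R]_M -> R) (q0 : 'cV[R]_M)
    (q qhat : 'I_T -> 'cV[R]_M) : R :=
  T%:R^-1 * (\sum_(t < T) l (fth q0 qhat t) (q t))
  - inf [set T%:R^-1 * (\sum_(t < T) l p (q t)) | p in simplex R M].

(* Main.v *)
(* An iterate of FTH sums to 1 but may have negative entries, whereas the
   gradient bound is only available on the simplex.  The gap is closed by two
   symmetries of the loss: it is invariant under positive scaling of p, and
   under scaling the negative entries of p alone, since neither changes which
   labels are maximal.  Letting the negative entries tend to 0 and using
   continuity at simplex points, p may be replaced by its positive part p^+.
   The segment from a distribution q to p^+ stays in the region where the
   entries are nonnegative and sum to at least 1; there, by homogeneity, the
   gradient is still bounded by L, so that
   l(p; .) - l(q; .) <= L |p^+ - q| <= L |p - q|.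

   By linearity of l in its second argument and symmetric optimality, the best
   fixed comparator is the average of the q_t, and the be-the-leader inequality
   bounds the regret by the sum of the l(p_t; q_t) - l(qbar_t; q_t), where
   qbar_t is the average of q_1, ..., q_t.  Here
   |p_t - qbar_t| <= |p_t - qbar_(t-1)| + 2/t, and Hoeffding's inequality with a
   union bound over coordinates and rounds makes the first term at most
   2 c sqrt(M ln T / (t - 1)).  Only the finitely many predicted labels matter,
   so the probability takes place on a finite product space.  The constant left
   over in the harmonic sum is absorbed because c >= 2. *)
Require Import Defs.
From mathcomp Require Import all_boot all_order all_algebra.
From mathcomp Require Import all_classical all_reals all_analysis.
From mathcomp Require Import ring lra.

Set Implicit Arguments.
Unset Strict Implicit.
Unset Printing Implicit Defensive.

Import Order.TTheory GRing.Theory Num.Theory.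
Import numFieldNormedType.Exports.

Local Open Scope classical_set_scope.
Local Open Scope ring_scope.

(** * Hoeffding inequality on a finite product space *)

Lemma MVT_ge0 (R : realType) (f df : R -> R) (h : R) :
  (forall x : R, is_derive x (1 : R) f (df x)) -> 0 <= h ->
  exists2 y, 0 <= y & f h - f 0 = df y * h.
Proof.
move=> dF h0.
have cf : {within `[0, h], continuous f}.
  by apply: derivable_within_continuous => x _; exact: ex_derive.
have [y] := MVT_segment h0 (fun x _ => dF x) cf.
by rewrite in_itv /= => /andP[y0 _] ->; exists y; rewrite ?subr0.
Qed.

(* The log of the right-hand side minus the log of the left-hand side has
   derivative K, which vanishes at 0 and is nondecreasing because u (1 - u) <= 1/4. *)
Lemma bernoulli_mgf_le (R : realType) (p h : R) : 0 <= p <= 1 -> 0 <= h ->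
  1 - p + p * expR h <= expR (h * p + h ^+ 2 / 8).
Proof.
move=> /andP[p0 p1] h0.
pose D (x : R) := 1 - p + p * expR x.
have D0 x : 0 < D x.
  rewrite /D; have := expR_gt0 x; nra.
have dD x : is_derive x (1:R) D (p * expR x).
  rewrite /D; apply: is_derive_eq; rewrite /GRing.scale /=; ring.
pose K (x : R) := p + x / 4 - 1 + (1 - p) * (D x)^-1.
have dV x : is_derive x (1:R) (fun x => (D x)^-1) (- (D x) ^- 2 * (p * expR x)).
  have d := dD x; apply: DeriveDef.
    by apply: derivableV; [rewrite gt_eqF|exact: ex_derive].
  by rewrite deriveV ?gt_eqF//= derive_val.
have dK x : is_derive x (1:R) K (4^-1 - (1 - p) * ((D x) ^- 2 * (p * expR x))).
  rewrite /K; apply: is_derive_eq; rewrite /GRing.scale /=; ring.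
have K0 x : 0 <= x -> 0 <= K x.
  move=> x0.
  have [y _] := MVT_ge0 dK x0.
  have -> : K 0 = 0.
    rewrite /K /D expR0; field.
    by apply/eqP; lra.
  rewrite subr0 => ->; apply: mulr_ge0 => //.
  (* With [u := p * expR y / D y], this is [1/4 - u (1 - u) = (1 - 2 u)^2 / 4]. *)
  have -> : 4^-1 - (1 - p) * (D y ^- 2 * (p * expR y)) =
     (1 - p - p * expR y) ^+ 2 / 4 / D y ^+ 2.
    rewrite /D; field; exact: lt0r_neq0 (D0 y).
  by rewrite divr_ge0 ?sqr_ge0// divr_ge0 ?sqr_ge0.
(* [F] is the quotient of the two sides. Its derivative is [- F K <= 0] and [F 0 = 1], so no
   logarithm has to be differentiated. *)
pose F (x : R) := D x * expR (- (x * p + x ^+ 2 / 8)).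
pose E (x : R) := expR (- (x * p + x ^+ 2 / 8)).
have dE x : is_derive x (1:R) E (- (p + x / 4) * E x).
  have d : is_derive x (1:R) (fun x : R => - (x * p + x ^+ 2 / 8)) (- (p + x / 4)).
    apply: is_derive_eq; rewrite /GRing.scale /=; field.
    by [].
  have -> : - (p + x / 4) * E x = E x * - (p + x / 4) by ring.
  exact: is_derive1_comp d.
have dF x : is_derive x (1:R) F (- (D x * E x * K x)).
  rewrite /F; apply: is_derive_eq; rewrite -/(E x) /GRing.scale /= /K.
  have -> : D x * E x * (p + x / 4 - 1 + (1 - p) * (D x)^-1) =
    E x * ((p + x / 4 - 1) * D x + (1 - p) * (D x / D x)) by ring.
  rewrite divff ?gt_eqF// /D; ring.
have F1 : F h <= 1.
  have [y y0] := MVT_ge0 dF h0.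
  have -> : F 0 = 1 by rewrite /F /D expr0n !mul0r addr0 oppr0 expR0; ring.
  move=> e; rewrite -subr_le0 e mulNr oppr_le0 !mulr_ge0 ?expR_ge0 ?K0//.
  exact: ltW.
by move: F1; rewrite /F expRN -ler_pdivlMr ?invr_gt0 ?expR_gt0// invrK mul1r.
Qed.

(** Convexity of the exponential, [x] being the combination of [a] and [b] with these two
    weights. *)
Lemma expR_chord_le (R : realType) (a b x m lam : R) : a < b -> a <= x <= b ->
  expR (lam * (x - m)) <=
  (b - x) / (b - a) * expR (lam * (a - m)) + (x - a) / (b - a) * expR (lam * (b - m)).
Proof.
move=> ab /andP[ax xb].
have ba : 0 < b - a by rewrite subr_gt0.
have t01 : 0 <= (x - a) / (b - a) <= 1.
  by rewrite divr_ge0 ?subr_ge0 ?(ltW ab)//= ler_pdivrMr// mul1r lerB.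
pose t := Itv01 (andP t01).1 (andP t01).2.
have := convex_expR t (lam * (b - m)) (lam * (a - m)).
rewrite !convRE /=.
have -> : unstable.onem ((x - a) / (b - a)) = (b - x) / (b - a).
  by rewrite /unstable.onem; field; rewrite gt_eqF.
rewrite [leRHS]addrC => H; apply: le_trans H.
rewrite le_eqVlt; apply/orP; left; apply/eqP; congr expR.
by field; rewrite gt_eqF.
Qed.

(** Hoeffding's lemma. Averaging the chord bound replaces the law by the two-point law on [a], [b]
    with the same mean, and [bernoulli_mgf_le] applies with [h = lam (b - a)]. *)
Lemma hoeffding_mgf (R : realType) (I : finType) (w x : I -> R) (a b lam : R) :
  (forall i, 0 <= w i) -> \sum_i w i = 1 -> a < b ->
  (forall i, a <= x i <= b) -> 0 <= lam ->
  \sum_i w i * expR (lam * (x i - \sum_j w j * x j)) <=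
  expR (lam ^+ 2 * (b - a) ^+ 2 / 8).
Proof.
move=> w0 w1 ab xab lam0; set m := \sum_j w j * x j.
have ba : 0 < b - a by rewrite subr_gt0.
have baN0 : b - a != 0 by rewrite gt_eqF.
pose p := (m - a) / (b - a).
have Ea : \sum_i w i * (b - x i) = b - m.
  rewrite /m -[b in RHS]mul1r -w1 mulr_suml -sumrB.
  by apply: eq_bigr => i _; rewrite mulrBr.
have Eb : \sum_i w i * (x i - a) = m - a.
  rewrite /m -[a in RHS]mul1r -w1 mulr_suml -sumrB.
  by apply: eq_bigr => i _; rewrite mulrBr.
have p01 : 0 <= p <= 1.
  rewrite /p divr_ge0 ?(ltW ba)//= -?Eb ?sumr_ge0//; last first.
    by move=> i _; rewrite mulr_ge0 ?w0// subr_ge0; case/andP: (xab i).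
  rewrite ler_pdivrMr// mul1r Eb lerD2r -subr_ge0 -Ea sumr_ge0// => i _.
  by rewrite mulr_ge0 ?w0// subr_ge0; case/andP: (xab i).
apply: (@le_trans _ _ (\sum_i (w i * (b - x i) * (expR (lam * (a - m)) / (b - a)) +
   w i * (x i - a) * (expR (lam * (b - m)) / (b - a))))).
  apply: ler_sum => i _.
  apply: le_trans (ler_wpM2l (w0 i) (expR_chord_le m lam ab (xab i))) _.
  by rewrite le_eqVlt; apply/orP; left; apply/eqP; ring.
rewrite big_split /= -!mulr_suml Ea Eb.
have := bernoulli_mgf_le p01 (mulr_ge0 lam0 (ltW ba)).
rewrite expRD -ler_pdivrMl ?expR_gt0// -expRN exprMn => H; apply: le_trans H.
have -> : lam * (a - m) = - (lam * (b - a) * p) by rewrite /p; field.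
have -> : lam * (b - m) = - (lam * (b - a) * p) + lam * (b - a) by rewrite /p; field.
rewrite expRD le_eqVlt; apply/orP; left; apply/eqP.
by rewrite {4 5}/p; field.
Qed.

(** Chernoff's method on the product law of the [w t]: the indicator of the event is at most
    [expR (lam (S - eps))], [S] being the centred sum over [A]. *)
Lemma hoeffding_tail (R : realType) (J I : finType) (w x : J -> I -> R)
    (A : {set J}) (a b eps : R) :
  (forall t i, 0 <= w t i) -> (forall t, \sum_i w t i = 1) -> a < b ->
  (forall t i, a <= x t i <= b) -> A != finset.set0 -> 0 <= eps ->
  \sum_(d : {ffun J -> I} |
      eps <= \sum_(t in A) (x t (d t) - \sum_i w t i * x t i))
    \prod_t w t (d t) <= expR (- (2 * eps ^+ 2 / (#|A|%:R * (b - a) ^+ 2))).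
Proof.
move=> w0 w1 ab xab A0 e0.
have k0 : 0 < #|A|%:R :> R by rewrite ltr0n card_gt0.
have ba : 0 < b - a by rewrite subr_gt0.
pose m t := \sum_i w t i * x t i.
(* The minimizer of the exponent [lam^2 #|A| (b - a)^2 / 8 - lam eps]. *)
pose lam := 4 * eps / (#|A|%:R * (b - a) ^+ 2).
have lam0 : 0 <= lam.
  by apply: divr_ge0; apply: mulr_ge0; rewrite ?sqr_ge0 ?ler0n.
pose G t i := w t i * (if t \in A then expR (lam * (x t i - m t)) else 1).
apply: (@le_trans _ _ (\sum_(d : {ffun J -> I}) expR (- (lam * eps)) * \prod_t G t (d t))).
  rewrite big_mkcond /=; apply: ler_sum => d _.
  have W0 : 0 <= \prod_t w t (d t) by exact: prodr_ge0.
  have -> : \prod_t G t (d t) = \prod_t w t (d t) * expR (lam * \sum_(t in A) (x t (d t) - m t)).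
    by rewrite big_split /= -big_mkcond /= mulr_sumr expR_sum.
  rewrite mulrCA -expRD; case: ifP => [h|_]; last by rewrite mulr_ge0 ?expR_ge0.
  rewrite ler_peMr// -[leLHS]expR0 ler_expR addrC subr_ge0; exact: ler_wpM2l.
(* Independence: the sum of products is a product of sums, whose factors outside [A] equal 1. *)
rewrite -mulr_sumr -(bigA_distr_bigA (fun t i => G t i)).
apply: (@le_trans _ _ (expR (- (lam * eps)) * \prod_(t in A) expR (lam ^+ 2 * (b - a) ^+ 2 / 8))).
  rewrite ler_wpM2l ?expR_ge0// [leRHS]big_mkcond /=; apply: ler_prod => t _.
  apply/andP; split.
    by apply: sumr_ge0 => i _; rewrite mulr_ge0//; case: ifP; rewrite ?expR_ge0.
  rewrite /G; case: ifP => tA; first exact: hoeffding_mgf.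
  by under eq_bigr do rewrite mulr1; rewrite w1.
rewrite prodr_const -expRM_natl -expRD ler_expR /lam le_eqVlt; apply/orP; left; apply/eqP.
field.
by rewrite !gt_eqF.
Qed.

(** * Lipschitz bound off the simplex *)

Lemma l2norm_ge0 (R : realType) (M : nat) (v : 'cV[R]_M) : 0 <= l2norm v.
Proof. exact: sqrtr_ge0. Qed.

Lemma sqr_l2norm (R : realType) (M : nat) (v : 'cV[R]_M) :
  l2norm v ^+ 2 = \sum_i v i 0 ^+ 2.
Proof. by rewrite sqr_sqrtr// sumr_ge0// => i _; exact: sqr_ge0. Qed.

Lemma l2norm_le (R : realType) (M : nat) (u v : 'cV[R]_M) :
  (forall i, `|u i 0| <= `|v i 0|) -> l2norm u <= l2norm v.
Proof.
move=> uv; rewrite ler_wsqrtr//; apply: ler_sum => i _.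
by rewrite -[leLHS]real_normK ?num_real// -[leRHS]real_normK ?num_real// lerXn2r ?nnegrE.
Qed.

Lemma l2normZ (R : realType) (M : nat) (c : R) (v : 'cV[R]_M) :
  l2norm (c *: v) = `|c| * l2norm v.
Proof.
rewrite /l2norm -sqrtr_sqr -sqrtrM ?sqr_ge0//; congr Num.sqrt.
by rewrite mulr_sumr; apply: eq_bigr => i _; rewrite !mxE exprMn.
Qed.

Lemma cauchy_schwarz_l2norm (R : realType) (M : nat) (u v : 'cV[R]_M) :
  \sum_i u i 0 * v i 0 <= l2norm u * l2norm v.
Proof.
have key w : l2norm w = 0 -> forall i : 'I_M, w i 0 = 0 :> R.
  move=> w0 i; have := sqr_l2norm w; rewrite w0 expr0n /= => /esym/eqP.
  rewrite psumr_eq0; last by move=> j _; exact: sqr_ge0.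
  by move=> /allP/(_ i); rewrite mem_index_enum sqrf_eq0 => /(_ isT) /eqP.
have [u0|u0] := eqVneq (l2norm u) 0.
  by rewrite u0 mul0r big1// => i _; rewrite key// mul0r.
have [v0|v0] := eqVneq (l2norm v) 0.
  by rewrite v0 mulr0 big1// => i _; rewrite [v i 0]key// mulr0.
have a0 : 0 < l2norm u by rewrite lt_def u0 l2norm_ge0.
have b0 : 0 < l2norm v by rewrite lt_def v0 l2norm_ge0.
(* This square expands to [2 |u| |v| (|u| |v| - <u, v>)]; the positive factor is then cancelled. *)
have : 0 <= \sum_i (l2norm v * u i 0 - l2norm u * v i 0) ^+ 2.
  by apply: sumr_ge0 => i _; exact: sqr_ge0.
have -> : \sum_i (l2norm v * u i 0 - l2norm u * v i 0) ^+ 2 =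
   l2norm v ^+ 2 * (\sum_i u i 0 ^+ 2) + l2norm u ^+ 2 * (\sum_i v i 0 ^+ 2)
   - 2 * (l2norm u * l2norm v) * (\sum_i u i 0 * v i 0).
  by rewrite !mulr_sumr -big_split /= -sumrB; apply: eq_bigr => i _; ring.
rewrite -!sqr_l2norm => h.
have ab0 := mulr_gt0 a0 b0.
rewrite -(ler_pM2l ab0); nra.
Qed.

Lemma l2normD (R : realType) (M : nat) (u v : 'cV[R]_M) :
  l2norm (u + v) <= l2norm u + l2norm v.
Proof.
rewrite -(@ler_pXn2r _ 2)// ?nnegrE ?addr_ge0 ?l2norm_ge0//.
rewrite sqr_l2norm sqrrD !sqr_l2norm.
have -> : \sum_i (u + v) i 0 ^+ 2 =
    \sum_i u i 0 ^+ 2 + (\sum_i u i 0 * v i 0) *+ 2 + \sum_i v i 0 ^+ 2.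
  by rewrite -sumrMnl -!big_split /=; apply: eq_bigr => i _; rewrite mxE sqrrD.
by rewrite lerD2r lerD2l lerMn2r /= cauchy_schwarz_l2norm.
Qed.

Lemma l2norm_le_max (R : realType) (M : nat) (v : 'cV[R]_M) (e : R) :
  0 <= e -> (forall i, `|v i 0| <= e) -> l2norm v <= Num.sqrt M%:R * e.
Proof.
move=> e0 ve; rewrite -[e in leRHS]ger0_norm// -sqrtr_sqr -sqrtrM ?ler0n// ler_wsqrtr//.
have -> : M%:R * e ^+ 2 = \sum_(i < M) e ^+ 2 by rewrite sumr_const card_ord mulr_natl.
apply: ler_sum => i _.
by rewrite -[leLHS]real_normK ?num_real// lerXn2r ?nnegrE.
Qed.

Lemma l2norm_simplex (R : realType) (M : nat) (p : 'cV[R]_M) :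
  simplex R M p -> l2norm p <= 1.
Proof.
move=> [p0 p1]; rewrite -sqrtr1 ler_wsqrtr// -p1; apply: ler_sum => i _.
have : p i 0 <= 1.
  by rewrite -p1 (bigD1 i)//= lerDl sumr_ge0.
by have := p0 i; nra.
Qed.

Lemma derive_le_grad (R : realType) (M : nat) (f : 'cV[R]_M -> R^o) (p v : 'cV[R]_M) :
  differentiable f p -> 'D_v f p <= l2norm (grad f p) * l2norm v.
Proof.
move=> df; apply: le_trans (cauchy_schwarz_l2norm _ _).
rewrite deriveE// {1}[v]matrix_sum_delta linear_sum /=.
rewrite le_eqVlt; apply/orP; left; apply/eqP; apply: eq_bigr => i _.
by rewrite big_ord1 linearZ /= mxE deriveE// [RHS]mulrC.
Qed.

(** Both difference quotients are the same function of [h]. *)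
Lemma derive_line (R : realType) (M : nat) (f : 'cV[R]_M -> R^o) (x v : 'cV[R]_M) (t : R) :
  derivable f (x + t *: v) v ->
  is_derive t (1 : R) (fun t : R => f (x + t *: v)) ('D_v f (x + t *: v)).
Proof.
have E : (fun h : R => h^-1 *:
      (((fun t : R => f (x + t *: v)) \o shift t) (h *: (1 : R)) - f (x + t *: v)))
  = (fun h => h^-1 *: ((f \o shift (x + t *: v)) (h *: v) - f (x + t *: v))).
  apply/funext => h /=; congr (_ *: (f _ - _)).
  by rewrite scalerDl [_%:A]mulr1 addrCA.
by move=> d; apply: DeriveDef; rewrite /derivable /derive E.
Qed.

Lemma normalized_simplex (R : realType) (M : nat) (r : 'cV[R]_M) :
  (forall i, 0 <= r i 0) -> 1 <= \sum_i r i 0 ->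
  simplex R M ((\sum_i r i 0)^-1 *: r).
Proof.
move=> r0 r1; have s0 : 0 < \sum_i r i 0 by exact: lt_le_trans r1.
split=> [i|]; first by rewrite mxE mulr_ge0// invr_ge0 ltW.
under eq_bigr do rewrite mxE.
by rewrite -mulr_sumr mulVf// gt_eqF.
Qed.

(* The derivative at r in direction v is the one at r / |r|_1 in direction
   v / |r|_1, and |r|_1 >= 1. *)
Lemma cone_lipschitz (R : realType) (M : nat) (f : 'cV[R]_M -> R^o) (L : R)
    (r q : 'cV[R]_M) :
  (forall (c : R) (p : 'cV[R]_M), 0 < c -> f (c *: p) = f p) ->
  (forall p, simplex R M p -> differentiable f p) ->
  (forall p, simplex R M p -> l2norm (grad f p) <= L) ->
  simplex R M q -> (forall i, 0 <= r i 0) -> 1 <= \sum_i r i 0 ->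
  f r - f q <= L * l2norm (r - q).
Proof.
move=> fZ df fL [q0 q1] r0 r1; set v := r - q.
have D (t : R) : 0 <= t <= 1 -> exists2 d : R,
    is_derive t (1 : R) (fun t : R => f (q + t *: v)) d & d <= L * l2norm v.
  move=> /andP[t0 t1].
  have y0 i : 0 <= (q + t *: v) i 0.
    by have := q0 i; have := r0 i; rewrite !mxE; nra.
  have y1 : 1 <= \sum_i (q + t *: v) i 0.
    have -> : \sum_i (q + t *: v) i 0 = (1 - t) + t * \sum_i r i 0.
      rewrite -[1 - t]mulr1 -{2}q1 !mulr_sumr -big_split /=.
      by apply: eq_bigr => i _; rewrite !mxE; ring.
    nra.
  have := normalized_simplex y0 y1; set s := \sum_i _ in y1 *.
  have s0 : 0 < s by exact: lt_le_trans y1.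
  rewrite scalerDr scalerA mulrC -scalerA => S.
  have d : derivable f _ (s^-1 *: v) := diff_derivable (df _ S).
  exists ('D_(s^-1 *: v) f (s^-1 *: q + t *: (s^-1 *: v))).
    (* The whole line is rescaled by the constant [s^-1], chosen to put its point at parameter [t]
       on the simplex. *)
    have -> : (fun t : R => f (q + t *: v)) = (fun t : R => f (s^-1 *: q + t *: (s^-1 *: v))).
      apply/funext => u; rewrite scalerA mulrC -scalerA -scalerDr fZ//.
      by rewrite invr_gt0.
    exact: derive_line.
  apply: le_trans (derive_le_grad _ (df _ S)) _.
  apply: ler_pM; rewrite ?l2norm_ge0 ?fL// l2normZ.
  rewrite ger0_norm ?invr_ge0 ?(ltW s0)//.
  by rewrite ler_piMl ?l2norm_ge0// invf_le1.
have cf : {within `[0, (1 : R)], continuous (fun t : R => f (q + t *: v))}.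
  apply: derivable_within_continuous => x; rewrite in_itv => /D[d h _].
  exact: ex_derive.
have [|t t01] := MVT_segment ler01 (df := fun t => 'D_1 (fun t : R => f (q + t *: v)) t) _ cf.
  move=> x; rewrite in_itv /= => /andP[x0 x1].
  have [|d h _] := D x; first by rewrite !ltW.
  by rewrite derive_val.
move: t01; rewrite in_itv => /D[d h dL].
rewrite scale0r addr0 scale1r subr0 mulr1 /v [q + (r - q)]addrC subrK => ->.
by rewrite derive_val.
Qed.

Lemma clip_invariant (R : realType) (M : nat) (f : 'cV[R]_M -> R^o) (p : 'cV[R]_M) :
  (forall (c : R) (p : 'cV[R]_M), 0 < c -> f (c *: p) = f p) ->
  (forall (eps : R) (p : 'cV[R]_M), 0 < eps ->
     f (\col_i (if 0 <= p i 0 then p i 0 else eps * p i 0)) = f p) ->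
  (forall p, simplex R M p -> differentiable f p) ->
  1 <= \sum_i p i 0 ->
  f (\col_i Num.max (p i 0) 0) = f p.
Proof.
move=> fZ fE df p1; pose r := \col_i Num.max (p i 0) 0 : 'cV[R]_M.
pose m := \col_i Num.min (p i 0) 0 : 'cV[R]_M.
have r0 i : 0 <= r i 0 by rewrite mxE le_max lexx orbT.
have r1 : 1 <= \sum_i r i 0.
  by apply: le_trans p1 _; apply: ler_sum => i _; rewrite mxE le_max lexx.
have := normalized_simplex r0 r1; set s := \sum_i _ in r1 *.
have s0 : 0 < s by exact: lt_le_trans r1.
move=> S.
(* For [t > 0], [r + t *: m] is [p] with its negative entries scaled by [t], so [phi] is constantly
   [f p] there; at 0 it is [f r], and continuity joins the two. *)
pose phi (t : R) := f (s^-1 *: r + t *: (s^-1 *: m)).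
have dphi : derivable phi 0 (1 : R).
  have := @derive_line _ _ f (s^-1 *: r) (s^-1 *: m) 0.
  by rewrite scale0r addr0 => /(_ (diff_derivable (df _ S))) h; exact: ex_derive.
have phi0 : phi 0 = f r by rewrite /phi scale0r addr0 fZ ?invr_gt0.
have phiE t : 0 < t -> phi t = f p.
  move=> t0; rewrite /phi scalerA mulrC -scalerA -scalerDr fZ ?invr_gt0// -(fE t p t0).
  congr f; apply/colP => i; rewrite !mxE.
  case: leP => pi.
    by rewrite mulr0 addr0.
  by rewrite add0r.
rewrite -/r -phi0.
have : {for 0, continuous phi}.
  by apply: differentiable_continuous; rewrite -derivable1_diffP.
move=> /cvg_at_right_filter => c1.
have c2 : phi x @[x --> 0^'+] --> f p.
  apply: cvg_near_cst; near=> x; apply: phiE; near: x; exact: nbhs_right_gt.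
exact: cvg_unique c1 c2.
Unshelve. all: by end_near. Qed.

Lemma clip_lipschitz (R : realType) (M : nat) (f : 'cV[R]_M -> R^o) (L : R)
    (p q : 'cV[R]_M) :
  (forall (c : R) (p : 'cV[R]_M), 0 < c -> f (c *: p) = f p) ->
  (forall (eps : R) (p : 'cV[R]_M), 0 < eps ->
     f (\col_i (if 0 <= p i 0 then p i 0 else eps * p i 0)) = f p) ->
  (forall p, simplex R M p -> differentiable f p) ->
  (forall p, simplex R M p -> l2norm (grad f p) <= L) ->
  simplex R M q -> 1 <= \sum_i p i 0 ->
  f p - f q <= L * l2norm (p - q).
Proof.
move=> fZ fE df fL Sq p1; rewrite -(clip_invariant fZ fE df p1).
have L0 : 0 <= L by apply: le_trans (fL _ Sq); exact: l2norm_ge0.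
apply: le_trans (cone_lipschitz fZ df fL Sq _ _) _.
- by move=> i; rewrite mxE le_max lexx orbT.
- by apply: le_trans p1 _; apply: ler_sum => i _; rewrite mxE le_max lexx.
(* As [q i 0 >= 0], clipping [p i 0] at 0 only brings it closer to [q i 0]. *)
apply: ler_wpM2l => //; apply: l2norm_le => i; rewrite !mxE.
have q0 := Sq.1 i; case: (leP (p i 0) 0) => pi0 //.
rewrite sub0r normrN ger0_norm// ler_normr; apply/orP; right; lra.
Qed.

(** * Regret of follow-the-history *)

(** Sequences on [nat] allow induction on the horizon. For [k = 0] the value is the zero vector,
    outside the simplex. *)
Definition average (R : realType) (M : nat) (u : nat -> 'cV[R]_M) (k : nat) : 'cV[R]_M :=
  k%:R^-1 *: \sum_(s < k) u s.

Lemma average_simplex (R : realType) (M : nat) (u : nat -> 'cV[R]_M) (k : nat) :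
  (0 < k)%N -> (forall s, (s < k)%N -> simplex R M (u s)) -> simplex R M (average u k).
Proof.
move=> k0 Su; split=> [i|].
  rewrite mxE summxE mulr_ge0 ?invr_ge0 ?ler0n ?sumr_ge0// => s _.
  exact: (Su s (ltn_ord s)).1.
under eq_bigr do rewrite mxE summxE.
rewrite -mulr_sumr exchange_big /= (eq_bigr (fun=> 1)) => [|s _].
  by rewrite sumr_const card_ord mulVf// pnatr_eq0 -lt0n.
exact: (Su s (ltn_ord s)).2.
Qed.

(** The running-mean recursion, which bounds the drift of the average in one round. *)
Lemma averageS (R : realType) (M : nat) (u : nat -> 'cV[R]_M) (k : nat) :
  (0 < k)%N -> average u k - average u k.+1 = k.+1%:R^-1 *: (average u k - u k).
Proof.
move=> k0; rewrite {2}/average big_ord_recr /=.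
have -> : \sum_(s < k) u s = k%:R *: average u k.
  by rewrite scalerA divff ?scale1r// pnatr_eq0 -lt0n.
move: (average u k) => a; apply/colP => i; rewrite !mxE -natr1.
by field; rewrite natr1 !pnatr_eq0.
Qed.

Lemma l2norm_simplexB (R : realType) (M : nat) (p q : 'cV[R]_M) :
  simplex R M p -> simplex R M q -> l2norm (p - q) <= 2.
Proof.
move=> Sp Sq; apply: le_trans (l2normD _ _) _.
rewrite -scaleN1r l2normZ normrN1 mul1r.
by rewrite -[2]/(1 + 1) lerD ?l2norm_simplex.
Qed.

(** Each new term is at most an increment of [ln], by [ln (1 - x) <= - x] at [x = T.+2%:R^-1]. *)
Lemma harmonic_le_ln (R : realType) (T : nat) : (0 < T)%N ->
  \sum_(t < T) t.+1%:R^-1 <= 1 + ln T%:R :> R.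
Proof.
case: T => // T _; elim: T => [|T IH].
  by rewrite big_ord1 invr1 ln1 addr0.
rewrite big_ord_recr /=; apply: le_trans (lerD IH (lexx _)) _.
rewrite -addrA lerD2l -lerBrDl -lerN2 opprB.
have T1 : 0 < T.+1%:R :> R by rewrite ltr0n.
have T2 : 0 < T.+2%:R :> R by rewrite ltr0n.
rewrite -ln_div ?posrE//.
have -> : T.+1%:R / T.+2%:R = 1 + (- T.+2%:R^-1) :> R.
  have -> : T.+1%:R = T.+2%:R - 1 :> R by rewrite -[in RHS]natr1 addrK.
  by rewrite mulrBl divff ?gt_eqF// mul1r.
by apply: le_ln1Dx; rewrite ltrN2 invf_lt1// ltr1n.
Qed.

(** With [b^2 - a^2 = 1], [2 (b - a) - 1 / b = (b - a)^2 / b >= 0]. The [- 1] for [T > 0] later pays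
    for the constant of the harmonic sum. *)
Lemma sum_sqrtV_le (R : realType) (T : nat) :
  \sum_(t < T) (if t == 0%N :> nat then 0 else (Num.sqrt t%:R)^-1) <=
  2 * Num.sqrt T%:R - (0 < T)%:R :> R.
Proof.
case: T => [|T]; first by rewrite big_ord0 sqrtr0 mulr0 subr0.
rewrite big_ord_recl /= add0r; case: T => [|T].
  by rewrite big_ord0 sqrtr1 mulr1 subr_ge0 lerDl.
apply: (@le_trans _ _ (2 * Num.sqrt T.+1%:R - 1)); last first.
  by rewrite lerD2r ler_pM2l// ler_wsqrtr// ler_nat.
elim: T => [|T IH]; first by rewrite big_ord1 /= sqrtr1; lra.
rewrite big_ord_recr /=; apply: le_trans (lerD IH (lexx _)) _.
rewrite /bump /= add1n.
have a0 : 0 <= Num.sqrt T.+1%:R :> R by exact: sqrtr_ge0.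
have b0 : 0 < Num.sqrt T.+2%:R :> R by rewrite sqrtr_gt0 ltr0n.
have a2 : Num.sqrt T.+1%:R ^+ 2 = T.+1%:R :> R by rewrite sqr_sqrtr.
have b2 : Num.sqrt T.+2%:R ^+ 2 = T.+1%:R + 1 :> R by rewrite sqr_sqrtr// natr1.
move: (Num.sqrt T.+1%:R) (Num.sqrt T.+2%:R) a0 b0 a2 b2 => a b a0 b0 a2 b2.
have -> : b^-1 = (b ^+ 2 - a ^+ 2) / b by rewrite a2 b2 addrAC subrr add0r mul1r.
rewrite -subr_ge0 -(pmulr_rge0 _ b0).
have -> : b * (2 * b - 1 - (2 * a - 1 + (b ^+ 2 - a ^+ 2) / b)) = (b - a) ^+ 2.
  by field; rewrite gt_eqF.
exact: sqr_ge0.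
Qed.

Section follow_the_history.
Variables (R : realType) (M : nat) (l : 'cV[R]_M -> 'cV[R]_M -> R).
Hypothesis l_linear : forall p a u v, l p (a *: u + v) = a * l p u + l p v.
Hypothesis l_opt : forall r p, simplex R M r -> simplex R M p -> l r r <= l p r.

Let lD p u v : l p (u + v) = l p u + l p v.
Proof. by rewrite -[u]scale1r l_linear mul1r scale1r. Qed.

Let l0 p : l p 0 = 0.
Proof. by have := l_linear p 1 0 0; rewrite scale1r addr0 mul1r; lra. Qed.

Lemma loss_scale p a u : l p (a *: u) = a * l p u.
Proof. by rewrite -[a *: u]addr0 l_linear l0 addr0. Qed.

Lemma loss_sum p (I : Type) (s : seq I) (P : pred I) (u : I -> 'cV[R]_M) :
  l p (\sum_(i <- s | P i) u i) = \sum_(i <- s | P i) l p (u i).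
Proof. by elim/big_rec2 : _ => [|i y1 y2 _ <-]; rewrite ?l0// lD. Qed.

(** By linearity and [l_opt], the average of the first [T] marginals minimizes their total loss, so
    replacing it by the next average only increases that loss. *)
Lemma be_the_leader (q : nat -> 'cV[R]_M) (T : nat) :
  (forall t, (t < T)%N -> simplex R M (q t)) ->
  \sum_(t < T) l (average q t.+1) (q t) <= l (average q T) (\sum_(t < T) q t).
Proof.
elim: T => [|T IH] Sq; first by rewrite !big_ord0 l0.
rewrite !big_ord_recr /= lD lerD2r.
apply: le_trans (IH _) _; first by move=> t tT; apply: Sq; exact: ltnW.
(* The empty average is not in the simplex, so optimality is invoked only from one round on. *)
case: T IH Sq => [|T] _ Sq; first by rewrite !big_ord0 !l0.
have -> : \sum_(t < T.+1) q t = T.+1%:R *: average q T.+1.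
  by rewrite scalerA divff ?scale1r// pnatr_eq0.
rewrite 2!loss_scale ler_pM2l ?ltr0n//; apply: l_opt.
  by apply: average_simplex => // t tT; apply: Sq; exact: ltnW.
exact: average_simplex.
Qed.

(** The iterate [average x t] is compared with the leader [average q t.+1] through [average q t]:
    the deviation costs [e / sqrt t], the drift [2 / (t + 1)]. At [t = 0] the iterate is [q0], at
    distance at most 2. *)
Lemma follow_the_history_le (q x : nat -> 'cV[R]_M) (q0 : 'cV[R]_M) (T : nat) (L e : R) :
  (forall p q r : 'cV[R]_M, \sum_i p i 0 = 1 -> simplex R M q -> simplex R M r ->
    l p r - l q r <= L * l2norm (p - q)) ->
  0 <= L -> (0 < T)%N -> simplex R M q0 -> (forall t, simplex R M (q t)) ->
  (forall t, \sum_i x t i 0 = 1) ->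
  (forall k, (0 < k < T)%N ->
     l2norm (average x k - average q k) <= e * (Num.sqrt k%:R)^-1) -> 0 <= e ->
  \sum_(t < T) l (if t == 0%N :> nat then q0 else average x t) (q t)
    <= l (average q T) (\sum_(t < T) q t)
       + L * (2 * (1 + ln T%:R) + e * (2 * Num.sqrt T%:R - 1)).
Proof.
move=> l_lip L0 T0 Sq0 Sq x1 dev e0.
apply: le_trans (lerD (be_the_leader (fun t _ => Sq t)) (lexx _)).
rewrite -lerBlDl -sumrB.
apply: (@le_trans _ _ (\sum_(t < T) (L * (2 * t.+1%:R^-1 +
    e * (if t == 0%N :> nat then 0 else (Num.sqrt t%:R)^-1))))); last first.
  rewrite -mulr_sumr ler_wpM2l// big_split /= -!mulr_sumr lerD//.
    by rewrite ler_pM2l// harmonic_le_ln.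
  by rewrite ler_wpM2l//; apply: le_trans (sum_sqrtV_le _ _) _; rewrite T0.
apply: ler_sum => -[t tT] _ /=.
have SA k : simplex R M (average q k.+1) by exact: average_simplex.
case: t tT => [|t] tT /=.
  apply: le_trans (l_lip _ _ _ Sq0.2 (SA _) (Sq _)) _.
  by rewrite ler_wpM2l// invr1 mulr1 mulr0 addr0 l2norm_simplexB.
apply: le_trans (l_lip _ _ _ _ (SA _) (Sq _)) _.
  under eq_bigr do rewrite mxE summxE.
  rewrite -mulr_sumr exchange_big /= (eq_bigr (fun=> 1)) => [|s _]; last exact: x1.
  by rewrite sumr_const card_ord mulVf// pnatr_eq0.
rewrite ler_wpM2l// -(subrK (average q t.+1) (average x t.+1)) -addrA.
apply: le_trans (l2normD _ _) _; rewrite [leRHS]addrC lerD ?dev//.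
rewrite averageS// l2normZ ger0_norm ?invr_ge0// mulrC ler_wpM2r ?invr_ge0//.
exact: l2norm_simplexB.
Qed.

End follow_the_history.

(** * Re-weighted classifiers and the label estimate *)

Lemma argmax_label_mono (R : realType) (M : nat) (tie : {set 'I_M} -> 'I_M)
    (w w' : 'I_M -> R) :
  (forall y y', (w y' <= w y) = (w' y' <= w' y)) ->
  argmax_label tie w = argmax_label tie w'.
Proof.
move=> ww; rewrite /argmax_label; congr tie; apply/setP => y; rewrite !inE.
by apply: eq_forallb => y'.
Qed.

Lemma reweighted_scale (R : realType) (X : Type) (M : nat) (tie : {set 'I_M} -> 'I_M)
    (Pf0 : X -> 'cV[R]_M) (q0 p : 'cV[R]_M) (c : R) : 0 < c ->
  reweighted tie Pf0 q0 (c *: p) = reweighted tie Pf0 q0 p.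
Proof.
move=> c0; apply/funext => x; apply: argmax_label_mono => y y'.
by rewrite !mxE -!mulrA ler_pM2l.
Qed.

(* Shrinking the negative weights towards 0 does not change their order. *)
Lemma reweighted_shrink_neg (R : realType) (X : Type) (M : nat)
    (tie : {set 'I_M} -> 'I_M) (Pf0 : X -> 'cV[R]_M) (q0 p : 'cV[R]_M) (eps : R) :
  0 < eps -> (forall i, 0 < q0 i 0) -> (forall x i, 0 <= Pf0 x i 0) ->
  reweighted tie Pf0 q0 (\col_i (if 0 <= p i 0 then p i 0 else eps * p i 0)) =
  reweighted tie Pf0 q0 p.
Proof.
move=> e0 q00 P0; apply/funext => x; apply: argmax_label_mono => y y'.
pose psi (u : R) := if 0 <= u then u else eps * u.
have psi_mono : {mono psi : u v / u <= v}.
  apply: le_mono => u v uv; rewrite /psi.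
  by case: (leP 0 u) => u0; case: (leP 0 v) => v0; nra.
(* [psi] commutes with multiplication by a nonnegative factor: a positive one keeps signs, and 0
   gives 0 on both sides. *)
have psiE z : (\col_i (if 0 <= p i 0 then p i 0 else eps * p i 0)) z 0 / q0 z 0 * Pf0 x z 0
    = psi (p z 0 / q0 z 0 * Pf0 x z 0).
  rewrite mxE -!mulrA; have : 0 <= (q0 z 0)^-1 * Pf0 x z 0.
    by rewrite mulr_ge0// invr_ge0 ltW.
  move: (_ * Pf0 x z 0) => k; rewrite le_eqVlt => /orP[/eqP <-|k0].
    by rewrite !mulr0 /psi lexx.
  by rewrite /psi pmulr_lge0//; case: ifP => _; rewrite ?mulrA.
by rewrite !psiE psi_mono.
Qed.

Lemma loss_linear (R : realType) (d : measure_display) (X : measurableType d) (n : nat)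
    (Q0 : probability (X * 'I_n.+1)%type R) (tie : {set 'I_n.+1} -> 'I_n.+1)
    (Pf0 : X -> 'cV[R]_n.+1) (p u v : 'cV[R]_n.+1) (a : R) :
  loss Q0 tie Pf0 p (a *: u + v) = a * loss Q0 tie Pf0 p u + loss Q0 tie Pf0 p v.
Proof.
rewrite /loss mulr_sumr -big_split /=; apply: eq_bigr => i _.
by rewrite !mxE; ring.
Qed.

(** A distance at most 0 forces the unique minimizer to be [r] itself. *)
Lemma symmetric_optimality_le (R : realType) (M : nat) (l : 'cV[R]_M -> 'cV[R]_M -> R)
    (r p : 'cV[R]_M) :
  symmetric_optimality l 0 -> simplex R M r -> simplex R M p -> l r r <= l p r.
Proof.
move=> opt Sr Sp; have [r' E d] := opt r Sr.
suff r'E : r' = r.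
  have [_] : argmin_on (simplex R M) (l^~ r) r by rewrite E r'E.
  exact.
have d0 : l2norm (r - r') = 0 by apply/eqP; rewrite eq_le d l2norm_ge0.
have := sqr_l2norm (r - r'); rewrite d0 expr0n /= => /esym/eqP.
rewrite psumr_eq0 => [/allP h|i _]; last exact: sqr_ge0.
apply/esym/eqP; rewrite -subr_eq0; apply/eqP/colP => i; apply/eqP.
by have := h i (mem_index_enum i); rewrite sqrf_eq0 [X in _ -> _ == X]mxE.
Qed.

(** The space is cut along the finitely many possible sets [B] of maximizers; on each piece the
    label is the constant [tie B]. *)
Lemma measurable_argmax_label (R : realType) (d : measure_display)
    (X : measurableType d) (M : nat) (tie : {set 'I_M} -> 'I_M)
    (w : X -> 'I_M -> R) (A : set 'I_M) :
  (forall i, measurable_fun setT (fun x => w x i)) ->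
  measurable [set x | A (argmax_label tie (w x))].
Proof.
move=> mw; pose S x : {set 'I_M} := [set y | [forall y', w x y' <= w x y]]%SET.
have -> : [set x | A (argmax_label tie (w x))] =
    \big[setU/set0]_(B : {set 'I_M} | `[< A (tie B) >])
      \big[setI/setT]_(y : 'I_M) [set x | (y \in B) = [forall y', w x y' <= w x y]].
  apply/seteqP; split=> x /=.
    move=> Ax; rewrite -bigcup_seq_cond; exists (S x) => /=.
      by rewrite mem_index_enum /=; exact/asboolP.
    by rewrite -bigcap_seq => y _ /=; rewrite inE.
  rewrite -bigcup_seq_cond => -[B /= /andP[_ /asboolP AB]].
  rewrite -bigcap_seq => h; rewrite /argmax_label.
  suff -> : [set y | [forall y', w x y' <= w x y]]%SET = B by [].
  by apply/setP => y; rewrite inE h//= mem_index_enum.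
apply: bigsetU_measurable => B _; apply: bigsetI_measurable => y _.
have mall : measurable [set x | [forall y', w x y' <= w x y]].
  have -> : [set x | [forall y', w x y' <= w x y]] =
      \big[setI/setT]_(y' : 'I_M) [set x | w x y' <= w x y].
    apply/seteqP; split=> x /=; rewrite -bigcap_seq /=.
      by move=> /forallP h y' _ /=; exact: h.
    by move=> h; apply/forallP => y'; apply: h; rewrite /= mem_index_enum.
  apply: bigsetI_measurable => y' _.
  rewrite -[X in measurable X]setTI; exact: measurable_fun_le.
case: (y \in B).
  rewrite [X in measurable X](_ : _ = [set x | [forall y', w x y' <= w x y]])//.
  by apply/seteqP; split=> x /=; [move=> <-|move=> ->].
rewrite [X in measurable X](_ : _ = ~` [set x | [forall y', w x y' <= w x y]]).
  exact: measurableC.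
by apply/seteqP; split=> x /=; [move=> <-|move/negP/negbTE ->].
Qed.

Lemma label_estimateE (R : realType) (M : nat) (C : 'M[R]_M) (i j : 'I_M) :
  label_estimate C j i 0 = invmx C^T i j.
Proof. by rewrite /label_estimate -colE mxE. Qed.

(** The all-ones row is fixed by [C^T], hence by its inverse. *)
Lemma label_estimate_sum (R : realType) (M : nat) (C : 'M[R]_M) (j : 'I_M) :
  C \in unitmx -> (forall i, \sum_j C i j = 1) ->
  \sum_i label_estimate C j i 0 = 1.
Proof.
move=> uC C1; have uCt : C^T \in unitmx by rewrite unitmx_tr.
have e : (const_mx 1 : 'rV[R]_M) *m C^T = const_mx 1.
  by apply/rowP => i; rewrite !mxE -[RHS](C1 i); apply: eq_bigr => k _; rewrite !mxE mul1r.
have := congr1 (fun v : 'rV[R]_M => (v *m invmx C^T) 0 j) e.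
rewrite mulmxK// mxE => /esym; rewrite mxE => <-.
by apply: eq_bigr => i _; rewrite label_estimateE mxE mul1r.
Qed.

(** Unbiasedness: if the true label has law [v], the predicted one has law [C^T v], which the
    inverse sends back to [v]. *)
Lemma label_estimate_mean (R : realType) (M : nat) (C : 'M[R]_M) (v : 'cV[R]_M) (i : 'I_M) :
  C \in unitmx ->
  \sum_j (\sum_k v k 0 * C k j) * label_estimate C j i 0 = v i 0.
Proof.
move=> uC; have uCt : C^T \in unitmx by rewrite unitmx_tr.
rewrite -[v in RHS](mulKmx uCt) [RHS]mxE; apply: eq_bigr => j _.
rewrite label_estimateE mulrC; congr (_ * _); rewrite mxE.
by apply: eq_bigr => k _; rewrite !mxE mulrC.
Qed.

Lemma label_estimate_norm (R : realType) (M : nat) (C : 'M[R]_M) (i j : 'I_M) :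
  `|label_estimate C j i 0| <= estimate_bound C / 2.
Proof.
rewrite /estimate_bound mulrAC divff// mul1r.
apply: (le_trans _ (le_bigmax _ _ j)).
rewrite [leRHS]/Num.norm /= mx_normrE.
exact: (le_bigmax _ (fun u => `|label_estimate C j u.1 u.2|) (i, 0)).
Qed.

(* The diagonal of (C^T)^-1 C^T is an average of entries of (C^T)^-1. *)
Lemma estimate_bound_ge2 (R : realType) (n : nat) (C : 'M[R]_n.+1) :
  C \in unitmx -> (forall i j, 0 <= C i j) -> (forall i, \sum_j C i j = 1) ->
  2 <= estimate_bound C.
Proof.
move=> uC C0 C1; have uCt : C^T \in unitmx by rewrite unitmx_tr.
suff : 1 <= estimate_bound C / 2 by lra.
have := congr1 (fun A : 'M[R]_n.+1 => A 0 0) (mulVmx uCt).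
rewrite [RHS]mxE eqxx /= mulr1n => /esym e; rewrite [leLHS]e mxE.
rewrite -[leRHS]mulr1 -[X in _ <= _ * X](C1 0) mulr_sumr; apply: ler_sum => j _.
rewrite [C^T j 0]mxE ler_wpM2r// -label_estimateE.
exact: le_trans (ler_norm _) (label_estimate_norm _ _ _).
Qed.

Lemma measure_preimage_sum (R : realType) (d : measure_display) (T : measurableType d)
    (mu : {measure set T -> \bar R}) (I : finType) (P : pred I) (f : T -> I) (B : set T) :
  measurable B -> (forall i, measurable (f @^-1` [set i])) ->
  mu (B `&` [set x | P (f x)]) = (\sum_(i | P i) mu (B `&` f @^-1` [set i]))%E.
Proof.
move=> mB mf.
have -> : B `&` [set x | P (f x)] = \bigcup_(i in [set` P]) (B `&` f @^-1` [set i]).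
  apply/seteqP; split=> x /=; first by move=> [Bx Px]; exists (f x).
  by move=> [i Pi [Bx fi]]; split=> //; move: fi => /= ->.
rewrite measure_fin_bigcup.
- rewrite [RHS]bigfs// ?index_enum_uniq// => i _.
  by rewrite mem_index_enum.
- exact: finite_finset.
- by move=> i j _ _ [x [[_ fi] [_ fj]]]; exact: etrans (esym fi) fj.
- by move=> i _; exact: measurableI.
Qed.

(** * Uniform concentration of the averaged estimates *)

Lemma union_bound (R : realType) (D K : finType) (B : K -> pred D) (F : D -> R) :
  (forall d, 0 <= F d) ->
  \sum_(d | [exists k, B k d]) F d <= \sum_k \sum_(d | B k d) F d.
Proof.
move=> F0; under [leRHS]eq_bigr do rewrite big_mkcond.
rewrite exchange_big big_mkcond /=; apply: ler_sum => d _.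
case: ifP => [/existsP[k Bk]|_]; last by apply: sumr_ge0 => k _; case: ifP.
by rewrite (bigD1 k)//= Bk lerDl sumr_ge0// => j _; case: ifP.
Qed.

(** The values range over an interval of length [c], so the threshold makes Hoeffding's exponent
    [2 * 4 c^2 k ln T / (k c^2) = 8 ln T]. *)
Lemma hoeffding_prefix_le (R : realType) (T : nat) (I : finType) (w : 'I_T -> I -> R)
    (x : I -> R) (m : 'I_T -> R) (c : R) (k : 'I_T) :
  (forall t i, 0 <= w t i) -> (forall t, \sum_i w t i = 1) -> 0 < c ->
  (forall i, `|x i| <= c / 2) -> (forall t, \sum_i w t i * x i = m t) -> (0 < k)%N ->
  \sum_(d : {ffun 'I_T -> I} | 2 * c * Num.sqrt (k%:R * ln T%:R) <=
       \sum_(t < T | (t < k)%N) (x (d t) - m t)) \prod_t w t (d t)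
    <= T%:R ^- 8.
Proof.
move=> w0 w1 c0 xc xm k0.
have T0 : (0 < T)%N by exact: leq_trans (ltn_ord k).
pose A := [set t : 'I_T | (t < k)%N]%SET.
have cA : #|A| = k.
  rewrite -sum1_card (eq_bigl (fun t : 'I_T => (t < k)%N)) => [|t]; last by rewrite inE.
  by rewrite -(big_ord_widen T (fun=> 1%N)) ?sum1_card ?card_ord// ltnW.
have A0 : A != finset.set0 by rewrite -card_gt0 cA.
have l0 : 0 <= ln T%:R :> R by rewrite ln_ge0// ler1n.
have e0 : 0 <= 2 * c * Num.sqrt (k%:R * ln T%:R).
  by rewrite mulr_ge0 ?sqrtr_ge0// mulr_ge0// ltW.
have ab : - (c / 2) < c / 2 by lra.
have xab (t : 'I_T) i : - (c / 2) <= x i <= c / 2 by rewrite -ler_norml.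
have := @hoeffding_tail R 'I_T I w (fun=> x) A _ _ _ w0 w1 ab xab A0 e0.
have -> : - (2 * (2 * c * Num.sqrt (k%:R * ln T%:R)) ^+ 2 /
    (#|A|%:R * (c / 2 - - (c / 2)) ^+ 2)) = - (8%:R * ln T%:R).
  rewrite cA exprMn sqr_sqrtr ?mulr_ge0//.
  by field; rewrite opprK pnatr_eq0 -lt0n k0 andbT gt_eqF// addr_gt0.
rewrite expRN expRM_natl lnK ?posrE ?ltr0n//; apply: le_trans.
rewrite le_eqVlt; apply/orP; left; apply/eqP; apply: eq_bigl => d.
congr (_ <= _); rewrite [RHS](eq_bigl (fun t : 'I_T => (t < k)%N)) => [|t]; last by rewrite inE.
by apply: eq_bigr => t _; rewrite xm.
Qed.

(** Union bound over [T] prefixes, [M] coordinates and two signs, each event having mass at most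
    [T^-8]. *)
Lemma average_deviation (R : realType) (T M : nat) (I : finType) (w : 'I_T -> I -> R)
    (x : I -> 'cV[R]_M) (q : 'I_T -> 'cV[R]_M) (c : R) :
  (forall t i, 0 <= w t i) -> (forall t, \sum_i w t i = 1) -> 0 < c ->
  (forall j i, `|x j i 0| <= c / 2) ->
  (forall t i, \sum_j w t j * x j i 0 = q t i 0) ->
  \sum_(d : {ffun 'I_T -> I} | [exists k : 'I_T, (0 < k)%N && [exists i : 'I_M,
      2 * c * Num.sqrt (k%:R * ln T%:R) <=
      `|\sum_(t < T | (t < k)%N) (x (d t) i 0 - q t i 0)| ]]) \prod_t w t (d t)
    <= 2 * M%:R * T%:R ^- 7.
Proof.
move=> w0 w1 c0 xc xq.
have W0 (d : {ffun 'I_T -> I}) : 0 <= \prod_t w t (d t) by exact: prodr_ge0.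
apply: le_trans (union_bound _ W0) _.
apply: (@le_trans _ _ (\sum_(k < T) 2 * M%:R * T%:R ^- 8)); last first.
  rewrite sumr_const card_ord -[leLHS]mulr_natr -[leLHS]mulrA ler_wpM2l ?mulr_ge0//.
  case: T {w q w0 w1 xq W0} => [|T]; first by rewrite mulr0 invr_ge0 exprn_ge0.
  by rewrite exprS invfM mulrAC mulVf ?mul1r// pnatr_eq0.
apply: ler_sum => k _; case: posnP => [|k0 /=].
  by rewrite big_pred0_eq !mulr_ge0 ?invr_ge0 ?exprn_ge0.
apply: le_trans (union_bound _ W0) _.
apply: (@le_trans _ _ (\sum_(i < M) (T%:R ^- 8 + T%:R ^- 8))); last first.
  by rewrite sumr_const card_ord -[leLHS]mulr_natr; lra.
apply: ler_sum => i _; set e := 2 * c * _.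
apply: (@le_trans _ _ (\sum_(d : {ffun 'I_T -> I} | e <=
      \sum_(t < T | (t < k)%N) (x (d t) i 0 - q t i 0)) \prod_t w t (d t) +
    \sum_(d : {ffun 'I_T -> I} | e <=
      \sum_(t < T | (t < k)%N) (- x (d t) i 0 - - q t i 0)) \prod_t w t (d t))).
  rewrite [leLHS]big_mkcond [X in _ <= X + _]big_mkcond [X in _ <= _ + X]big_mkcond.
  rewrite -big_split /=; apply: ler_sum => d _.
  have -> : \sum_(t < T | (t < k)%N) (- x (d t) i 0 - - q t i 0) =
      - \sum_(t < T | (t < k)%N) (x (d t) i 0 - q t i 0).
    by rewrite -sumrN; apply: eq_bigr => t _; ring.
  rewrite ler_normr; have := W0 d.
  by case: (e <= _); case: (e <= _) => /=; lra.
apply: lerD.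
  exact: (@hoeffding_prefix_le _ _ _ w (fun j => x j i 0) (fun t => q t i 0)).
apply: (@hoeffding_prefix_le _ _ _ w (fun j => - x j i 0) (fun t => - q t i 0)) => //.
  by move=> j; rewrite normrN.
by move=> t; under eq_bigr do rewrite mulrN; rewrite sumrN xq.
Qed.

(** * Regret on the event of small deviations *)

(** [inord] extends a family over the rounds to [nat]; only indices below [T.+1], where it is exact,
    are read. *)
Lemma fth_average (R : realType) (M T : nat) (q0 : 'cV[R]_M) (x : 'I_T.+1 -> 'cV[R]_M)
    (k : nat) : (k <= T.+1)%N ->
  fth q0 x k = if k == 0%N then q0 else average (fun s => x (inord s)) k.
Proof.
case: k => // k kT; rewrite /= /average.
rewrite (big_ord_widen T.+1 (fun s => x (inord s)))//; congr (_ *: _).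
by apply: eq_bigr => s _; rewrite inord_val.
Qed.

Lemma average_dist_le (R : realType) (M T : nat) (x q : 'I_T.+1 -> 'cV[R]_M) (k : 'I_T.+1)
    (a : R) : 0 <= a -> (0 < k)%N ->
  (forall i, `|\sum_(t < T.+1 | (t < k)%N) (x t i 0 - q t i 0)| <= a * Num.sqrt k%:R) ->
  l2norm (average (fun s => x (inord s)) k - average (fun s => q (inord s)) k)
    <= Num.sqrt M%:R * a * (Num.sqrt k%:R)^-1.
Proof.
move=> a0 k0 dev.
have s0 : 0 < Num.sqrt k%:R :> R by rewrite sqrtr_gt0 ltr0n.
have ks : k%:R = Num.sqrt k%:R ^+ 2 :> R by rewrite sqr_sqrtr.
have -> : Num.sqrt M%:R * a * (Num.sqrt k%:R)^-1 = Num.sqrt M%:R * (k%:R^-1 * (a * Num.sqrt k%:R)).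
  by rewrite [in X in X^-1 * _]ks; field; rewrite gt_eqF.
apply: l2norm_le_max => [|i]; first by rewrite mulr_ge0 ?invr_ge0// mulr_ge0// ltW.
rewrite /average -scalerBr mxE normrM ger0_norm ?invr_ge0// ler_wpM2l ?invr_ge0//.
apply: le_trans (dev i); rewrite le_eqVlt; apply/orP; left; apply/eqP; congr `|_|.
have kT := ltnW (ltn_ord k).
rewrite (big_ord_widen T.+1 (fun s => x (inord s)) kT).
rewrite (big_ord_widen T.+1 (fun s => q (inord s)) kT).
by rewrite -sumrB summxE; apply: eq_bigr => t _; rewrite !inord_val !mxE.
Qed.

Lemma ln_ge_half (R : realType) (T : nat) : (1 < T)%N -> 2^-1 <= ln T%:R :> R.
Proof.
move=> T1; apply: (@le_trans _ _ (ln 2)); last by rewrite ler_ln ?posrE ?ltr0n ?ler_nat// ltnW.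
rewrite -lerN2 -lnV ?posrE//.
rewrite (_ : ln 2^-1 = ln (1 + - 2^-1)); last by congr ln; lra.
by apply: le_ln1Dx; lra.
Qed.

Lemma fth_regret_le (R : realType) (M T : nat) (l : 'cV[R]_M -> 'cV[R]_M -> R)
    (q0 : 'cV[R]_M) (q x : 'I_T -> 'cV[R]_M) (L c : R) :
  (forall p a u v, l p (a *: u + v) = a * l p u + l p v) ->
  (forall r p, simplex R M r -> simplex R M p -> l r r <= l p r) ->
  (forall p q r : 'cV[R]_M, \sum_i p i 0 = 1 -> simplex R M q -> simplex R M r ->
    l p r - l q r <= L * l2norm (p - q)) ->
  0 <= L -> 2 <= c -> (1 < T)%N -> simplex R M q0 -> (forall t, simplex R M (q t)) ->
  (forall t, \sum_i x t i 0 = 1) ->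
  (forall (k : 'I_T) i, (0 < k)%N ->
    `|\sum_(t < T | (t < k)%N) (x t i 0 - q t i 0)| <= 2 * c * Num.sqrt (k%:R * ln T%:R)) ->
  fth_regret l q0 q x <=
    2 * L * (ln T%:R / T%:R) + 4 * L * c * Num.sqrt (M%:R * ln T%:R / T%:R).
Proof.
move=> l_linear l_opt l_lip L0 c2 T1 Sq0 Sq x1 dev.
have M0 : (0 < M)%N.
  move: Sq0 => [_]; case: (M) q0 => // q0'; rewrite big_ord0; lra.
case: T T1 q x Sq x1 dev => // T T1 q x Sq x1 dev.
have T0 : 0 < T.+1%:R :> R by rewrite ltr0n.
have l0 := ln_ge_half R T1.
pose qn s := q (inord s); pose xn s := x (inord s).
pose a := 2 * c * Num.sqrt (ln T.+1%:R).
have a0 : 0 <= a by rewrite mulr_ge0 ?sqrtr_ge0//; lra.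
have sumq : \sum_(t < T.+1) q t = \sum_(t < T.+1) qn t.
  by apply: eq_bigr => t _; rewrite /qn inord_val.
(* By linearity, a fixed comparator is judged against the average marginal, which is therefore the
   best one. *)
have avgE p : T.+1%:R^-1 * (\sum_(t < T.+1) l p (q t)) = l p (average qn T.+1).
  by rewrite (loss_scale l_linear) -sumq (loss_sum l_linear).
have SA : simplex R M (average qn T.+1) by apply: average_simplex => // s _; exact: Sq.
have infE : l (average qn T.+1) (average qn T.+1) <=
    inf [set T.+1%:R^-1 * (\sum_(t < T.+1) l p (q t)) | p in simplex R M].
  apply: lb_le_inf; first by exists (T.+1%:R^-1 * (\sum_(t < T.+1) l q0 (q t))); exists q0.
  by move=> _ [p Sp <-]; rewrite avgE; exact: l_opt.
rewrite /fth_regret; apply: le_trans (lerB (lexx _) infE) _.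
have devn k : (0 < k < T.+1)%N -> l2norm (average xn k - average qn k) <=
    Num.sqrt M%:R * a * (Num.sqrt k%:R)^-1.
  move=> /andP[k0 kT]; have := @average_dist_le R M T x q (Ordinal kT) a a0 k0; apply => i.
  have := dev (Ordinal kT) i k0; rewrite sqrtrM ?ler0n// /a.
  by rewrite -!mulrA [Num.sqrt (ln _) * _]mulrC.
have e0 : 0 <= Num.sqrt M%:R * a by rewrite mulr_ge0 ?sqrtr_ge0.
have := follow_the_history_le l_linear l_opt l_lip L0 (ltn0Sn T) Sq0 (fun t => Sq (inord t))
  (fun t => x1 (inord t)) devn e0.
have -> : \sum_(t < T.+1) l (if t == 0%N :> nat then q0 else average xn t) (qn t) =
    \sum_(t < T.+1) l (fth q0 x t) (q t).
  by apply: eq_bigr => t _; rewrite fth_average ?(ltnW (ltn_ord t))// /qn inord_val.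
have -> : l (average qn T.+1) (\sum_(t < T.+1) qn t) =
    T.+1%:R * l (average qn T.+1) (average qn T.+1).
  by rewrite [in RHS](loss_scale l_linear) mulrA divff ?mul1r// gt_eqF.
move=> H.
set sT := Num.sqrt T.+1%:R in H *.
have sT0 : 0 < sT by rewrite sqrtr_gt0.
have TsT : T.+1%:R = sT ^+ 2 by rewrite sqr_sqrtr// ltW.
pose s : R := Num.sqrt (M%:R * ln T.+1%:R).
have -> : Num.sqrt (M%:R * ln T.+1%:R / T.+1%:R) = s / sT.
  by rewrite sqrtrM ?sqrtrV// mulr_ge0//; lra.
have ea : Num.sqrt M%:R * a = 2 * c * s by rewrite /a /s sqrtrM//; ring.
have s1 : 2^-1 <= s.
  rewrite /s -[leLHS]ger0_norm// -sqrtr_sqr ler_wsqrtr//.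
  have : 1 <= M%:R :> R by rewrite ler1n.
  nra.
rewrite ea in H.
rewrite lerBlDr -(ler_pM2l T0) [leLHS]mulrA divff ?gt_eqF// mul1r; apply: le_trans H _.
rewrite [leRHS]mulrDr addrC lerD2r.
clearbody s; move: (ln T.+1%:R) l0 => lT l0.
have -> : T.+1%:R * (2 * L * (lT / T.+1%:R) + 4 * L * c * (s / sT)) =
    L * (2 * lT + 4 * c * s * sT).
  by rewrite [in LHS]TsT; field; rewrite gt_eqF.
(* What remains is [1 <= c * s], from [c2] and [s1]. *)
rewrite ler_wpM2l//; nra.
Qed.

(** * Laws of true and predicted labels *)

(** If label [i] has probability 0, both sides vanish, the right one by monotonicity. *)
Lemma marginal_class_cond (R : realType) (d : measure_display) (X : measurableType d)
    (n : nat) (Q : probability (X * 'I_n.+1)%type R) (i : 'I_n.+1) (A : set X) :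
  measurable A -> label_marginal Q i 0 * class_cond Q i A = fine (Q (A `*` [set i])).
Proof.
move=> mA; rewrite /class_cond [LHS]mulrC.
have mAi : measurable (A `*` [set i]) by exact: measurableX.
have mTi : measurable ([set: X] `*` [set i]) by exact: measurableX.
have [q0|q0] := eqVneq (label_marginal Q i 0) 0; last by rewrite divfK.
rewrite q0 mulr0; apply/esym/eqP; rewrite eq_le fine_ge0// andbT.
rewrite -q0 mxE; apply: fine_le; rewrite ?fin_num_measure//.
by apply: le_measure; rewrite ?inE//; apply: setSX.
Qed.

Lemma fine_probability_sum (R : realType) (d : measure_display) (T : measurableType d)
    (P : probability T R) (I : finType) (f : T -> I) (B : set T) :
  measurable B -> (forall i, measurable (f @^-1` [set i])) ->
  fine (P B) = \sum_i fine (P (B `&` f @^-1` [set i])).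
Proof.
move=> mB mf; rewrite sum_fine => [|i _]; last first.
  by rewrite fin_num_measure//; exact: measurableI.
rewrite -(measure_preimage_sum P xpredT mB mf); congr (fine (P _)).
by apply/seteqP; split => x //= -[].
Qed.

Lemma measurable_snd_label (d : measure_display) (X : measurableType d) (n : nat) (i : 'I_n.+1) :
  measurable ((snd : X * 'I_n.+1 -> 'I_n.+1) @^-1` [set i]).
Proof.
rewrite (_ : _ @^-1` _ = [set: X] `*` [set i]); first exact: measurableX.
by apply/seteqP; split=> x //= -[].
Qed.

Lemma measurable_fst_label (d : measure_display) (X : measurableType d) (n : nat)
    (f : X -> 'I_n.+1) (i : 'I_n.+1) :
  (forall j, measurable (f @^-1` [set j])) ->
  measurable ((fun u : X * 'I_n.+1 => f u.1) @^-1` [set i]).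
Proof.
move=> mf; rewrite (_ : _ @^-1` _ = (f @^-1` [set i]) `*` setT).
  exact: measurableX.
by apply/seteqP; split=> x //= -[].
Qed.

Lemma label_marginal_simplex (R : realType) (d : measure_display) (X : measurableType d)
    (n : nat) (Q : probability (X * 'I_n.+1)%type R) :
  simplex R n.+1 (label_marginal Q).
Proof.
split=> [i|]; first by rewrite mxE fine_ge0.
have := fine_probability_sum Q measurableT (@measurable_snd_label _ X n).
rewrite probability_setT /= => ->; apply: eq_bigr => i _; rewrite mxE setTI.
by congr (fine (Q _)); apply/seteqP; split=> x //= -[].
Qed.

Lemma confusion_ge0 (R : realType) (d : measure_display) (X : measurableType d)
    (n : nat) (Q : probability (X * 'I_n.+1)%type R) (f : X -> 'I_n.+1) i j :
  0 <= confusion Q f i j.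
Proof. by rewrite mxE divr_ge0// ?mxE fine_ge0. Qed.

Lemma confusion_row_sum (R : realType) (d : measure_display) (X : measurableType d)
    (n : nat) (Q : probability (X * 'I_n.+1)%type R) (f : X -> 'I_n.+1) i :
  (forall j, measurable (f @^-1` [set j])) -> 0 < label_marginal Q i 0 ->
  \sum_j confusion Q f i j = 1.
Proof.
move=> mf q0; under eq_bigr do rewrite mxE.
rewrite -mulr_suml; apply: (canLR (mulfK _)); first by rewrite gt_eqF.
have mTi : measurable ([set: X] `*` [set i]) by exact: measurableX.
rewrite mul1r mxE (fine_probability_sum Q mTi (fun j => measurable_fst_label j mf)).
apply: eq_bigr => j _; congr (fine (Q _)).
by apply/seteqP; split=> x /= [] // [].
Qed.

(** Total probability over the true label; labels that [Q] does not charge contribute 0 to both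
    sides. *)
Lemma predicted_marginal (R : realType) (d : measure_display) (X : measurableType d)
    (n : nat) (Q0 Q : probability (X * 'I_n.+1)%type R) (f : X -> 'I_n.+1) j :
  (forall j, measurable (f @^-1` [set j])) -> same_class_cond Q0 Q ->
  fine (Q ((fun u => f u.1) @^-1` [set j])) =
  \sum_k label_marginal Q k 0 * confusion Q0 f k j.
Proof.
move=> mf QQ.
rewrite (fine_probability_sum Q (measurable_fst_label j mf) (@measurable_snd_label _ X n)).
apply: eq_bigr => k _.
have -> : label_marginal Q k 0 * confusion Q0 f k j =
    label_marginal Q k 0 * class_cond Q k (f @^-1` [set j]).
  rewrite [confusion _ _ _ _]mxE; have := (label_marginal_simplex Q).1 k.
  rewrite le_eqVlt => /orP[/eqP <-|q0]; first by rewrite !mul0r.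
  by rewrite QQ.
by rewrite marginal_class_cond.
Qed.

(** Moves an event about the predictions to the finite product space: it is the disjoint union of
    the fibres over the prediction vectors [e], and each fibre factors by independence. *)
Lemma independent_labels_prob (R : realType) (d d' : measure_display)
    (Omega : measurableType d) (S : measurableType d') (P : probability Omega R)
    (J I : finType) (z : J -> {RV P >-> S}) (f : S -> I) (G : pred {ffun J -> I}) :
  mutually_independent P (fun t => z t : Omega -> S) ->
  (forall i, measurable (f @^-1` [set i])) ->
  P [set o | G [ffun t => f (z t o)]] =
  (\sum_(e | G e) \prod_t fine (P (z t @^-1` (f @^-1` [set e t]))))%:E.
Proof.
move=> ind mf; pose D o := [ffun t => f (z t o)].
have mz t A : measurable A -> measurable (z t @^-1` A).
  by move=> mA; rewrite -[X in measurable X]setTI; exact: measurable_funP.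
have DE e : D @^-1` [set e] = \bigcap_(t in [set` [set: J]%SET]) (z t @^-1` (f @^-1` [set e t])).
  apply/seteqP; split=> o /=; first by move=> <- t _ /=; rewrite ffunE.
  by move=> h; apply/ffunP => t; rewrite ffunE; apply: h; rewrite /= inE.
have mD e : measurable (D @^-1` [set e]).
  rewrite DE; apply: fin_bigcap_measurable; first exact: finite_finset.
  by move=> t _; apply: mz.
rewrite -[X in P X]setTI (measure_preimage_sum P G measurableT mD) -sumEFin.
apply: eq_bigr => e _; rewrite setTI DE.
have /= -> := ind [set: J]%SET (fun t => f @^-1` [set e t])
  (fun t => mf (e t)).
rewrite -prodEFin; apply: eq_big => [t|t _]; first by rewrite inE.
by rewrite fineK// fin_num_measure//; exact: mz.
Qed.

Lemma loss_lipschitz (R : realType) (d : measure_display) (X : measurableType d)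
    (n : nat) (Q0 : probability (X * 'I_n.+1)%type R) (tie : {set 'I_n.+1} -> 'I_n.+1)
    (Pf0 : X -> 'cV[R]_n.+1) (p q r : 'cV[R]_n.+1) :
  let l := loss Q0 tie Pf0 in
  (forall i, 0 < label_marginal Q0 i 0) -> (forall x i, 0 <= Pf0 x i 0) ->
  lipschitzness l -> \sum_i p i 0 = 1 -> simplex R n.+1 q -> simplex R n.+1 r ->
  l p r - l q r <= lipschitz_constant l * l2norm (p - q).
Proof.
move=> l q0 P0 [dl ubl] p1 Sq Sr.
apply: (@clip_lipschitz _ _ (fun p => l p r)) => //.
- by move=> c u c0; rewrite /l /loss reweighted_scale.
- by move=> e u e0; rewrite /l /loss reweighted_shrink_neg.
- by move=> u Su; exact: dl.
- by move=> u Su; apply: ub_le_sup => //; exists u => //; exists r.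
- by rewrite p1.
Qed.

(** * The regret bound with high probability *)

Theorem theorem3 (R : realType) (dX dO : measure_display)
    (X : measurableType dX) (n T : nat)
    (Q0 : probability (X * 'I_n.+1)%type R)
    (Q : 'I_T -> probability (X * 'I_n.+1)%type R)
    (tie : {set 'I_n.+1} -> 'I_n.+1) (Pf0 : X -> 'cV[R]_n.+1)
    (Omega : measurableType dO) (P : probability Omega R)
    (z : 'I_T -> {RV P >-> (X * 'I_n.+1)%type}) :
  let q0 := label_marginal Q0 in
  let q := fun t => label_marginal (Q t) in
  let f0 := base_classifier tie Pf0 in
  let C0 := confusion Q0 f0 in
  let l := loss Q0 tie Pf0 in
  let qhat := fun w t => label_estimate C0 (f0 (z t w).1) in
  let L := lipschitz_constant l in
  let c := estimate_bound C0 in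
  (1 <= T)%N ->
  (forall i, 0 < q0 i 0) ->
  (forall t, same_class_cond Q0 (Q t)) ->
  (forall A : {set 'I_n.+1}, A != finset.set0 -> tie A \in A) ->
  (forall x, simplex R n.+1 (Pf0 x)) ->
  (forall i, measurable_fun setT (fun x => Pf0 x i 0)) ->
  (forall t B, measurable B -> P (z t @^-1` B) = Q t B) ->
  mutually_independent P (fun t => z t : Omega -> X * 'I_n.+1) ->
  C0 \in unitmx ->
  symmetric_optimality l 0 ->
  lipschitzness l ->
  ((1 - 2 * n.+1%:R * T%:R ^- 7)%:E <=
     P [set w | (fth_regret l q0 q (qhat w) <=
                 2 * L * (ln T%:R / T%:R)
                 + 4 * L * c * Num.sqrt (n.+1%:R * ln T%:R / T%:R))%R])%E.
Proof.
move=> q0 q f0 C0 l qhat L c T0 q0_gt0 QQ tie_mem Pf0S mPf0 zQ ind uC opt lip.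
(* For [T = 1] the claimed probability is at most 0; later steps use [ln T >= 1/2]. *)
have [T1|T1] := leqP T 1.
  have TE : T = 1%N by apply/eqP; rewrite eqn_leq T1.
  apply: (@le_trans _ _ 0%E) => //.
  by rewrite lee_fin [in T%:R]TE expr1n invr1 mulr1 subr_le0 -natrM ler1n.
have mf j : measurable (f0 @^-1` [set j]).
  exact: (@measurable_argmax_label _ _ _ _ tie (fun x y => Pf0 x y 0) [set j]).
have mF (j : 'I_n.+1) := @measurable_fst_label _ X n f0 j mf.
have C1 i : \sum_j C0 i j = 1 by exact: confusion_row_sum.
have c2 : 2 <= c by apply: estimate_bound_ge2 => // i j; exact: confusion_ge0.
have Sq t : simplex R n.+1 (q t) := label_marginal_simplex (Q t).
have Sq0 : simplex R n.+1 q0 := label_marginal_simplex Q0.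
have l_lip p r s := @loss_lipschitz _ _ _ _ Q0 tie Pf0 p r s q0_gt0
  (fun x => (Pf0S x).1) lip.
have L0 : 0 <= L.
  apply: (le_trans (l2norm_ge0 (grad (fun p => l p q0 : R^o) q0))).
  by apply: ub_le_sup; [exact: lip.2|exists q0 => //; exists q0].
pose F (u : X * 'I_n.+1) := f0 u.1.
(* The law of the label predicted in round [t], namely [C0^T] applied to [q t]. *)
pose w t j := fine (P (z t @^-1` (F @^-1` [set j]))).
have wE t j : w t j = \sum_k q t k 0 * C0 k j.
  by rewrite /w zQ; [exact: predicted_marginal|exact: mF].
have w0 t j : 0 <= w t j by exact: fine_ge0.
have w1 t : \sum_j w t j = 1.
  under eq_bigr do rewrite wE.
  rewrite exchange_big /= -[RHS](Sq t).2; apply: eq_bigr => k _.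
  by rewrite -mulr_sumr C1 mulr1.
have wq t i : \sum_j w t j * label_estimate C0 j i 0 = q t i 0.
  by under eq_bigr do rewrite wE; exact: label_estimate_mean.
pose B := 2 * L * (ln T%:R / T%:R) + 4 * L * c * Num.sqrt (n.+1%:R * ln T%:R / T%:R).
pose G (e : {ffun 'I_T -> 'I_n.+1}) :=
  fth_regret l q0 q (fun t => label_estimate C0 (e t)) <= B.
have GE o : (fth_regret l q0 q (qhat o) <= B) = G [ffun t => F (z t o)].
  rewrite /G; suff -> : (fun t => label_estimate C0 ([ffun t => F (z t o)] t)) = qhat o by [].
  by apply/funext => t; rewrite ffunE.
have -> : [set o | fth_regret l q0 q (qhat o) <= B] = [set o | G [ffun t => F (z t o)]].
  by apply/funext => o; rewrite /mkset GE.
rewrite (independent_labels_prob G ind mF) lee_fin -/w.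
(* Since the total mass is 1, it suffices to bound the mass of the vectors violating [G]. *)
have : \sum_(e : {ffun 'I_T -> 'I_n.+1}) \prod_t w t (e t) = 1.
  by rewrite -(bigA_distr_bigA w) big1.
rewrite (bigID G) /= => W1; rewrite -[X in X - _]W1 lerBlDr lerD2l.
have c0 : 0 < c by lra.
apply: (le_trans _ (average_deviation w0 w1 c0 (fun j i => label_estimate_norm C0 i j) wq)).
rewrite [leLHS]big_mkcond [leRHS]big_mkcond; apply: ler_sum => e _.
have W0 : 0 <= \prod_t w t (e t) by exact: prodr_ge0.
case: ifPn => [Ge|_]; last by case: ifP.
(* A vector violating [G] lies in the deviation event: outside it, the deterministic bound yields
   [G]. *)
case: ifPn => // /existsPn h; case/negP: Ge; apply: fth_regret_le => //.
- by move=> p a u v; exact: loss_linear.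
- by move=> r p; exact: symmetric_optimality_le.
- by move=> t; exact: label_estimate_sum.
- move=> k i k0; have := h k; rewrite k0 /= => /existsPn/(_ i).
  by rewrite -ltNge => /ltW.
Qed.
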